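(* Let $m$ be a positive integer and $n\ge 2$ an integer, and let $\mathcal{R}=(r_1,\ldots,r_m)$, $\mathcal{C}=(c_1,\ldots,c_n)$ be sequences of integers with $n=r_1\ge r_2\ge\cdots\ge r_m$ and $m=c_1\ge c_2\ge\cdots\ge c_n$, and assume that $(\mathcal{R},\mathcal{C})$ is consistent. Let $F_2$ be the set produced by the procedure described in the context. Then \[ L_h(F_2)\le 4n-4. \]
   Context: For a finite set $F\subseteq\mathbb{Z}^2$, row $i$ is $\{(i,l)\}$ and column $j$ is $\{(k,j)\}$ (matrix convention). The row sum $r_i$ is the number of points of $F$ in row $i$ and the column sum $c_j$ the number of points of $F$ in column $j$. The pair $(\mathcal{R},\mathcal{C})$ is consistent if there exists $F\subseteq\{1,\ldots,m\}\times\{1,\ldots,n\}$ with these row and column sums. The uniquely determined neighbour is $F_1=\{(i,j):1\le j\le n,\ 1\le i\le c_j\}$. Boundary: $L_h(F)$ is the number of ordered pairs $((i,j),(i',j'))$ of points of $\mathbb{Z}^2$ with $|i-i'|=1$, $j=j'$, $(i,j)\in F$, $(i',j')\notin F$. The procedure. A state consists of a set $J\subseteq\{1,\ldots,n\}$ of remaining columns (initially all, with their original sums $c_j$) and current row sums $r_1,\ldots,r_m$ (initially the given ones). In the current state set $b_i=\#\{j\in J:c_j\ge i\}$, $d_i=b_i-r_i$ ($1\le i\le m$), $r_{m+1}=b_{m+1}=d_{m+1}=0$. If all $d_i=0$, stop. Otherwise let $i_1$ be minimal with $d_{i_1}>0$, $i_2$ minimal with $d_{i_2}>0$ and $d_{i_2+1}\le0$,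 $R^+=\{i_1,\ldots,i_2\}$; $i_3$ minimal with $d_{i_3}<0$, $i_4$ minimal with $d_{i_4}<0$ and $d_{i_4+1}\ge0$, $R^-=\{i_3,\ldots,i_4\}$. A-step (if $|R^+|\le|R^-|$): $j$ is the largest element of $J$ with $c_j\in R^+$, $s=c_j-i_1+1$. If $r_{i_3+s-1}>r_{i_3+s}$, $I=\{i_3,\ldots,i_3+s-1\}$; otherwise let $t_1$ be minimal with $i_3\le t_1\le i_3+s-1$ and $r_{t_1}=r_{i_3+s-1}$, $t_2\ge i_3+s$ with $r_{t_2}=r_{i_3+s-1}>r_{t_2+1}$, $t_3=t_2+t_1-i_3-s+1$, and $I=\{i_3,\ldots,t_1-1\}\cup\{t_3,\ldots,t_2\}$. Final column $j$: $\{(i,j):1\le i<i_1\}\cup\{(i,j):i\in I\}$. B-step (if $|R^+|>|R^-|$): $j$ is the smallest element of $J$ with $c_j+1\in R^-$, $s=i_4-c_j$. If $r_{i_2-s}>r_{i_2-s+1}$, $I=\{i_2-s+1,\ldots,i_2\}$; otherwise let $t_1$ be maximal with $i_2-s+1\le t_1\le i_2$ and $r_{t_1}=r_{i_2-s+1}$, $t_2\le i_2-s$ with $r_{t_2-1}>r_{t_2}=r_{i_2-s+1}$, $t_3=t_2+s-1-(i_2-t_1)$, and $I=\{t_2,\ldots,t_3\}\cup\{t_1+1,\ldots,i_2\}$. Final column $j$: $\{(i,j):1\le i\le c_j,\ i\notin I\}\cup\{(i,j):c_j+1\le i\le i_4\}$. After each step remove $j$ from $J$ and decrease $r_i$ by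 $1$ for every row $i$ meeting the final column $j$, then continue. At the end, each column $j$ still in $J$ gets final content $\{(i,j):1\le i\le c_j\}$. $F_2$ is the union of the final columns; it has row sums $\mathcal{R}$ and column sums $\mathcal{C}$. *)

(* Defs.v *)
From mathcomp Require Import all_boot all_order all_algebra.
From mathcomp Require Import finmap zify.

Set Implicit Arguments.
Unset Strict Implicit.
Unset Printing Implicit Defensive.

Import Order.TTheory GRing.Theory Num.Theory.

Local Open Scope ring_scope.

(* A point of Z^2 is a pair (row, column). *)
Notation point := (int * int)%type.

Definition vneighbours (p : point) : seq point :=
  [:: (p.1 - 1, p.2); (p.1 + 1, p.2)].

Definition hboundary (F : {fset point}) : {fset point * point} :=
  [fset pq in [seq (p, q) | p <- enum_fset F, q <- vneighbours p]
  | pq.2 \notin F]%fset.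

(* Only vertical neighbours of F are listed in [hboundary]; no boundary pair
   of Z^2 x Z^2 is lost. *)
Lemma in_hboundary (F : {fset point}) (p q : point) :
  ((p, q) \in hboundary F) =
  [&& `|p.1 - q.1| == 1, p.2 == q.2, p \in F & q \notin F].
Proof.
have vnE (x y : point) :
    (y \in vneighbours x) = (`|x.1 - y.1| == 1) && (x.2 == y.2).
  by case: x y => [i j] [i' j']; rewrite !inE !xpair_eqE /=; lia.
transitivity (((p, q) \in [seq (x, y) | x <- enum_fset F, y <- vneighbours x])
              && (q \notin F)).
  by rewrite /hboundary in_fset inE andbC.
rewrite !andbA; congr (_ && _).
apply/allpairsPdep/idP => [[x [y [xF yx [-> ->]]]]|].
  by rewrite -vnE yx; apply: xF.
by rewrite -vnE => /andP[pq pF]; exists p, q.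
Qed.

Definition Lh (F : {fset point}) : nat := #|` hboundary F|%fset.

Definition row_sum (F : {fset point}) (i : int) : nat :=
  #|` [fset p in F | p.1 == i]|%fset.

Definition col_sum (F : {fset point}) (j : int) : nat :=
  #|` [fset p in F | p.2 == j]|%fset.

(* 1-based entry of a sequence: [entry s i] is s_i for 1 <= i <= size s. *)
Definition entry (s : seq int) (i : int) : int := nth 0 s `|i|.-1.

Definition consistent (m n : nat) (R : m.-tuple int) (C : n.-tuple int) : Prop :=
  exists F : {fset point},
    [/\ forall p, p \in F -> (1 <= p.1 <= m%:Z) && (1 <= p.2 <= n%:Z),
        forall i : int, 1 <= i <= m%:Z -> (row_sum F i)%:Z = entry R i
      & forall j : int, 1 <= j <= n%:Z -> (col_sum F j)%:Z = entry C j].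

(* The integers a, a + 1, ..., b in increasing order; empty if b < a. *)
Definition irange (a b : int) : seq int :=
  if a <= b then [seq a + k%:Z | k <- iota 0 `|b - a|.+1] else [::].

Lemma mem_irange (a b i : int) : (i \in irange a b) = (a <= i <= b).
Proof.
rewrite /irange; case: ifP => le_ab; last by rewrite in_nil; lia.
apply/mapP/idP => [[k]|le_aib]; first by rewrite mem_iota => ? ->; lia.
by exists `|i - a|%N; rewrite ?mem_iota; lia.
Qed.

(* Least and greatest i in {a, ..., b} such that P i; 0 if there is none. *)
Definition least_in (a b : int) (P : pred int) : int :=
  head 0 [seq i <- irange a b | P i].
Definition greatest_in (a b : int) (P : pred int) : int :=
  last 0 [seq i <- irange a b | P i].

(* [rem_cols] is the set J, always listed in increasing order; [fin_pts] lists
   the points of the final columns constructed so far. *)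
Record state := State {
  rem_cols : seq int;
  cur_rows : int -> int;
  fin_pts : seq point
}.

Section Procedure.
Variables (m : nat) (c : int -> int).

Definition on_rows (f : int -> int) (i : int) : int :=
  if 1 <= i <= m%:Z then f i else 0.

Definition r_of (st : state) : int -> int := on_rows (cur_rows st).

Definition b_of (st : state) : int -> int :=
  on_rows (fun i => (count (fun j => i <= c j) (rem_cols st))%:Z).

Definition d_of (st : state) (i : int) : int := b_of st i - r_of st i.

Definition i1_of st := least_in 1 m%:Z (fun i => 0 < d_of st i).
Definition i2_of st :=
  least_in 1 m%:Z (fun i => (0 < d_of st i) && (d_of st (i + 1) <= 0)).
Definition i3_of st := least_in 1 m%:Z (fun i => d_of st i < 0).
Definition i4_of st :=
  least_in 1 m%:Z (fun i => (d_of st i < 0) && (0 <= d_of st (i + 1))).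

Definition Rplus st : seq int := irange (i1_of st) (i2_of st).
Definition Rminus st : seq int := irange (i3_of st) (i4_of st).

(* A column to be finalised, together with the list of its final rows. The row
   t2 below is unique because the current row sums stay nonincreasing. *)
Definition A_step (st : state) : int * seq int :=
  let r := r_of st in
  let i1 := i1_of st in
  let i3 := i3_of st in
  let j := last 0 [seq j <- rem_cols st | c j \in Rplus st] in
  let s := c j - i1 + 1 in
  let I :=
    if r (i3 + s) < r (i3 + s - 1) then irange i3 (i3 + s - 1)
    else
      let t1 := least_in i3 (i3 + s - 1) (fun t => r t == r (i3 + s - 1)) in
      let t2 := least_in (i3 + s) m%:Z
        (fun t => (r t == r (i3 + s - 1)) && (r (t + 1) < r (i3 + s - 1))) in
      let t3 := t2 + t1 - i3 - s + 1 in
      irange i3 (t1 - 1) ++ irange t3 t2 in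
  (j, irange 1 (i1 - 1) ++ I).

(* Again t2 is unique. The row sum r_0, which is 0 here, is not constrained by
   the procedure: t2 > 1 whenever t2 is needed, since row 1 is always full in
   the remaining columns. *)
Definition B_step (st : state) : int * seq int :=
  let r := r_of st in
  let i2 := i2_of st in
  let i4 := i4_of st in
  let j := head 0 [seq j <- rem_cols st | c j + 1 \in Rminus st] in
  let s := i4 - c j in
  let I :=
    if r (i2 - s + 1) < r (i2 - s) then irange (i2 - s + 1) i2
    else
      let t1 := greatest_in (i2 - s + 1) i2 (fun t => r t == r (i2 - s + 1)) in
      let t2 := least_in 1 (i2 - s)
        (fun t => (r t < r (t - 1)) && (r t == r (i2 - s + 1))) in
      let t3 := t2 + s - 1 - (i2 - t1) in
      irange t2 t3 ++ irange (t1 + 1) i2 in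
  (j, [seq i <- irange 1 (c j) | i \notin I] ++ irange (c j + 1) i4).

Definition finalise (st : state) (jcol : int * seq int) : state :=
  let: (j, col) := jcol in
  State [seq k <- rem_cols st | k != j]
        (fun i => cur_rows st i - (i \in col)%:R)
        (fin_pts st ++ [seq (i, j) | i <- col]).

Definition stopped (st : state) : bool :=
  all (fun i => d_of st i == 0) (irange 1 m%:Z).

Definition step (st : state) : state :=
  if stopped st then st
  else if (size (Rplus st) <= size (Rminus st))%N then finalise st (A_step st)
  else finalise st (B_step st).

End Procedure.

(* A state in which the procedure stops is fixed by [step] and every other step
   removes one of the n columns, so n iterations reach the stopping state. *)
Definition F2_pts (m n : nat) (R : m.-tuple int) (C : n.-tuple int) : seq point :=
  let c := entry C in
  let st := iter n (step m c) (State (irange 1 n%:Z) (entry R) [::]) in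
  fin_pts st ++ [seq (i, j) | j <- rem_cols st, i <- irange 1 (c j)].

Definition F2 (m n : nat) (R : m.-tuple int) (C : n.-tuple int) : {fset point} :=
  [fset p in F2_pts R C]%fset.

(* Main.v *)
Require Import Defs.
From mathcomp Require Import all_boot all_order all_algebra.
From mathcomp Require Import finmap zify.

Import Order.TTheory GRing.Theory Num.Theory.

Local Open Scope ring_scope.

(* A column that is a union of k intervals contributes at most 2k to L_h, so it
   suffices to write F_2 as a union of at most 2n - 2 vertical segments. An
   untouched column costs one segment and a step costs two or three. Let
   d = b - r, let w_p = b_p - b_(p+1) be the number of remaining columns with
   sum p, and consider the weight
     Phi = sum_(1 <= p <= m) (min(w_p, d_p^+) + min(w_p, d_(p+1)^-)).
   At the start Phi <= n - 1, because d_m <= 0 makes the term p = m vanish. The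
   step that finalises column j lowers the term p = c_j by 1. An A-step with
   i_3 in I (a B-step with i_2 in I) also lowers the term p = i_3 - 1 (p = i_2)
   by 1, since there w_p >= d_p - d_(p+1). A step whose set I comes from the
   rows t_1, t_2, t_3 leaves d_(t_1) nonzero, so it is never the last one, and
   it costs three segments only if Phi drops by 2; any other step costs two
   segments and lowers Phi by 2. Hence
     #segments + #remaining columns + Phi - [the procedure has not stopped]
   never increases, and it is at most 2n - 2 initially. *)

(** * Partial sums over integer intervals and the dominance profile of a state *)

Lemma int_upward_ind (P : int -> Prop) (a : int) :
  P a -> (forall k : int, a <= k -> P k -> P (k + 1)) -> forall k : int, a <= k -> P k.
Proof.
move=> Pa PS k ak.
have -> : k = a + `|k - a|%N%:Z by lia.
elim: `|k - a|%N => [|n IHn]; first by rewrite addr0.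
have -> : a + n.+1%:Z = a + n%:Z + 1 by lia.
by apply: PS => //; lia.
Qed.

(** A partial sum is any S with increments d. The same lemma then serves the sums of b - r and,
    through successive differences, plain monotonicity. *)
Lemma sumint_le (S d : int -> int) (a b : int) : a <= b ->
  (forall i : int, a < i <= b -> S i = S (i - 1) + d i) ->
  (forall i : int, a < i <= b -> 0 <= d i) -> S a <= S b.
Proof.
move=> ab; apply: (@int_upward_ind (fun b =>
  (forall i : int, a < i <= b -> S i = S (i - 1) + d i) ->
  (forall i : int, a < i <= b -> 0 <= d i) -> S a <= S b)) ab => //.
move=> k ak IHk Sd d0.
have le_ak : S a <= S k by apply: IHk => i ?; [apply: Sd | apply: d0]; lia.
have := Sd (k + 1); have := d0 (k + 1); rewrite (_ : k + 1 - 1 = k); lia.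
Qed.

Lemma sumint_ge (S d : int -> int) (a b : int) : a <= b ->
  (forall i : int, a < i <= b -> S i = S (i - 1) + d i) ->
  (forall i : int, a < i <= b -> d i <= 0) -> S b <= S a.
Proof.
move=> ab Sd d0.
have := @sumint_le (fun i => - S i) (fun i => - d i) a b ab.
by move=> H; suff: - S a <= - S b; [lia | apply: H => i /[dup] /Sd + /d0; lia].
Qed.

Lemma le_antitone (f : int -> int) (a b : int) :
  (forall i : int, a <= i < b -> f (i + 1) <= f i) ->
  forall i j, a <= i -> i <= j -> j <= b -> f j <= f i.
Proof.
move=> fS i j ai ij jb.
apply: (@sumint_ge f (fun i => f i - f (i - 1)) i j ij) => k ?; first lia.
have := fS (k - 1); rewrite subrK; lia.
Qed.

(* The function in [prof_sum] is i |-> \sum_(1 <= k <= i) (b k - r k); its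
   nonnegativity is the dominance condition of Gale and Ryser. *)
Record profile (m : nat) (b r : int -> int) : Prop := Profile {
  prof_b : forall i j : int, 1 <= i -> i <= j -> j <= m%:Z + 1 -> b j <= b i;
  prof_r : forall i j : int, 1 <= i -> i <= j -> j <= m%:Z + 1 -> r j <= r i;
  prof_bm : b (m%:Z + 1) = 0;
  prof_rm : r (m%:Z + 1) = 0;
  prof_1 : b 1 = r 1;
  prof_sum : exists S : int -> int,
    [/\ S 0 = 0, S m%:Z = 0,
        forall i : int, 1 <= i <= m%:Z -> S i = S (i - 1) + (b i - r i)
      & forall i : int, 0 <= i <= m%:Z -> 0 <= S i]
}.

(** The intervals i1..i2 and i3..i4 are R^+ and R^-. As i1 < i3, [blk_d1] and [blk_d3] together
    force d = 0 on the rows before i1. *)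
Record blocks (m : nat) (d : int -> int) (i1 i2 i3 i4 : int) : Prop := Blocks {
  blk_i1 : 1 < i1;
  blk_i12 : i1 <= i2;
  blk_i23 : i2 < i3;
  blk_i34 : i3 <= i4;
  blk_i4 : i4 <= m%:Z;
  blk_d1 : forall i : int, 1 <= i < i1 -> d i <= 0;
  blk_d12 : forall i : int, i1 <= i <= i2 -> 0 < d i;
  blk_d2 : d (i2 + 1) <= 0;
  blk_d3 : forall i : int, 1 <= i < i3 -> 0 <= d i;
  blk_d34 : forall i : int, i3 <= i <= i4 -> d i < 0;
  blk_d4 : 0 <= d (i4 + 1)
}.

(* Before i3 and from i4 on the new partial sums are clearly nonnegative; on
   i3..i4 they decrease towards the value at i4. *)
Lemma profile_transfer (m : nat) (b r b' r' T : int -> int) (u v : int -> bool)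
    (i3 i4 : int) :
  profile m b r -> 1 <= i3 -> i3 <= i4 -> i4 <= m%:Z ->
  (forall i : int, 1 <= i < i3 -> 0 <= b i - r i) ->
  (forall i : int, i3 <= i <= i4 -> b i - r i < 0) ->
  (forall i : int, 1 <= i <= m%:Z -> b' (i + 1) <= b' i) ->
  (forall i : int, 1 <= i <= m%:Z -> r' (i + 1) <= r' i) ->
  b' (m%:Z + 1) = 0 -> r' (m%:Z + 1) = 0 ->
  (forall i : int, 1 <= i <= m%:Z ->
     b' i - r' i = b i - r i - (u i)%:Z + (v i)%:Z) ->
  (forall i : int, u i -> 0 < b i - r i) ->
  (forall i : int, v i -> b i - r i < 0) ->
  T 0 = 0 ->
  (forall i : int, 1 <= i <= m%:Z -> T i = T (i - 1) - (u i)%:Z + (v i)%:Z) ->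
  (forall i : int, i4 <= i <= m%:Z -> T i = 0) ->
  profile m b' r'.
Proof.
move=> prof i3_ge1 i34 i4m dpos dneg b'S r'S b'm r'm dE upos vneg T0 TS T4.
have [S [S0 Sm SS Sge]] := prof_sum _ _ _ prof.
split=> //.
- by apply: le_antitone => i ?; apply: b'S; lia.
- by apply: le_antitone => i ?; apply: r'S; lia.
- have := dE 1; have := upos 1; have := vneg 1; have := prof_1 _ _ _ prof.
  by case: (u 1); case: (v 1) => /=; lia.
have SS' (i : int) : 1 <= i <= m%:Z ->
    S i + T i = S (i - 1) + T (i - 1) + (b' i - r' i).
  by move=> ?; rewrite SS // TS // dE //; lia.
exists (fun i => S i + T i); split=> //; first by rewrite S0 T0.
  by rewrite Sm T4 //; lia.
move=> i im.
have [i_lt|i_ge] := ltP i i3.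
  have le0i : 0 <= i by lia.
  have := @sumint_le (fun i => S i + T i) (fun i => b' i - r' i) 0 i le0i.
  rewrite S0 T0 addr0; apply=> k ?; first by apply: SS'; lia.
  rewrite dE; last lia.
  by have := dpos k; have := upos k; case: (u k); case: (v k) => /=; lia.
have [i4i|ii4] := leP i4 i; first by rewrite T4 ?addr0; [apply: Sge|]; lia.
have lei4 : i <= i4 by lia.
apply: (@le_trans _ _ (S i4 + T i4)).
  by rewrite T4 ?addr0; [apply: Sge|]; lia.
apply: (@sumint_ge (fun i => S i + T i) (fun i => b' i - r' i)) => // k ?.
  by apply: SS'; lia.
rewrite dE; last lia.
by have := dneg k; have := vneg k; case: (u k); case: (v k) => /=; lia.
Qed.

(** * The weight Phi and its drop under a step *)

Definition wt (b r : int -> int) (p : int) : int :=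
  Num.min (b p - b (p + 1)) (Num.max 0 (b p - r p)) +
  Num.min (b p - b (p + 1)) (Num.max 0 (r (p + 1) - b (p + 1))).

Definition weight (m : nat) (b r : int -> int) : int :=
  \sum_(1 <= p < m.+1) wt b r p%:Z.

Lemma sum_eq_ind (m : nat) (c : int) : 1 <= c <= m%:Z ->
  \sum_(1 <= p < m.+1) (p%:Z == c)%:Z = 1.
Proof.
move=> cm; rewrite (bigD1_seq `|c|%N) /=; last exact: iota_uniq.
- rewrite big_nat_cond big1 ?addr0; first by rewrite (_ : _ == c); lia.
  by move=> p; lia.
- by rewrite mem_index_iota; lia.
Qed.

Lemma weight_drop (m : nat) (b r b' r' : int -> int) (c q : int) (f : bool) :
  1 <= c <= m%:Z -> 1 <= q <= m%:Z ->
  (forall p : int, 1 <= p <= m%:Z ->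
     wt b' r' p + (p == c)%:Z + (f && (p == q))%:Z <= wt b r p) ->
  weight m b' r' + 1 + f%:Z <= weight m b r.
Proof.
move=> cm qm le_wt.
have -> : f%:Z = \sum_(1 <= p < m.+1) (f && (p%:Z == q))%:Z.
  by case: f {le_wt} => /=; [rewrite sum_eq_ind | rewrite big1].
rewrite -(sum_eq_ind _ _ cm) -!big_split /=.
rewrite big_nat [leRHS]big_nat; apply: ler_sum => p ?; apply: le_wt; lia.
Qed.

(** Used with w = w_p, x = d_p, y = -d_(p+1) for an A-step, and with x and y exchanged for a B-step;
    [x + y <= w] then says that r is nonincreasing. The first min pays for e because e lowers w and
    x together. If f holds, 0 <= x gives y <= w, so the second min is y itself and falls by 1. *)
Lemma wt_step (w x y : int) (u v u1 v1 e f : bool) :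
  0 <= w - e%:Z -> x + y <= w ->
  (u -> 0 < x) -> (v -> x < 0) -> (v1 -> 0 < y) -> (u1 -> y < 0) ->
  (e -> u) -> (f -> v1 /\ 0 <= x) ->
  Num.min (w - e%:Z) (Num.max 0 (x - u%:Z + v%:Z)) +
    Num.min (w - e%:Z) (Num.max 0 (y - v1%:Z + u1%:Z)) + e%:Z + f%:Z <=
  Num.min w (Num.max 0 x) + Num.min w (Num.max 0 y).
Proof.
move=> w0 xyw ux vx v1y u1y eu fv.
have P : Num.min (w - e%:Z) (Num.max 0 (x - u%:Z + v%:Z)) + e%:Z <=
    Num.min w (Num.max 0 x).
  by move: eu ux vx; case: e w0 {fv}; case: u; case: v; lia.
have Q : Num.min (w - e%:Z) (Num.max 0 (y - v1%:Z + u1%:Z)) + f%:Z <=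
    Num.min w (Num.max 0 y).
  case: f fv => [[]// v1T x0|_]; last first.
    by move: v1y u1y; case: e w0 {eu P}; case: v1; case: u1; lia.
  have u1F : u1 = false by apply/negP => /u1y; have := v1y v1T; lia.
  have := v1y v1T; rewrite v1T u1F /= => y0.
  by move: eu ux; case: e w0 {P}; case: u; lia.
lia.
Qed.

(* The number of k' <= k in the interval a..b. *)
Definition cnt (a b k : int) : int := Num.max 0 (Num.min k b - a + 1).

Lemma cntS (a b k : int) : cnt a b k = cnt a b (k - 1) + (a <= k <= b)%R%:Z.
Proof. by rewrite /cnt; case: (boolP (a <= k <= b)); lia. Qed.

Lemma cnt_low (a b k : int) : k < a -> cnt a b k = 0.
Proof. by rewrite /cnt; lia. Qed.

Lemma cnt_high (a b k : int) : a <= b + 1 -> b <= k -> cnt a b k = b - a + 1.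
Proof. by rewrite /cnt; lia. Qed.

(* The first case of the A-step is t1 = t3 = i3 + s, t2 = i3 + s - 1. *)
Lemma A_profile (m : nat) (b r b' r' : int -> int)
    (i1 i2 i3 i4 c t1 t2 t3 : int) :
  profile m b r -> blocks m (fun i => b i - r i) i1 i2 i3 i4 ->
  i1 <= c <= i2 ->
  (forall i : int, 1 <= i <= m%:Z + 1 -> b' i = b i - (i <= c)%R%:Z) ->
  (forall i : int, 1 <= i <= m%:Z -> b' (i + 1) <= b' i) ->
  (forall i : int, 1 <= i <= m%:Z + 1 ->
    r' i = r i - [|| i < i1, i3 <= i < t1 | t3 <= i <= t2]%R%:Z) ->
  i3 <= t1 -> t1 <= t3 -> t3 <= t2 + 1 -> t2 <= i4 ->
  t1 - i3 + (t2 - t3 + 1) = c - i1 + 1 ->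
  (i3 < t1 -> r t1 < r (t1 - 1)) -> r (t2 + 1) < r t2 ->
  profile m b' r' /\ weight m b' r' + 1 + (i3 < t1)%R%:Z <= weight m b r.
Proof.
move=> prof [i1_gt1 i12 i23 i34 i4m d1 d12 d2 d3 d34 d4] c12 b'E b'S r'E.
move=> i3t1 t13 t32 t24 sE rt1 rt2.
have := prof => -[pb pr bm rm b1 _].
pose u (i : int) := i1 <= i <= c.
pose v (i : int) := (i3 <= i < t1) || (t3 <= i <= t2).
have dE (i : int) : 1 <= i <= m%:Z + 1 ->
    b' i - r' i = b i - r i - (u i)%:Z + (v i)%:Z.
  by move=> im; rewrite b'E // r'E // /u /v; clear -c12 i23 i3t1 i12 t13 ; lia.
have upos (i : int) : u i -> 0 < b i - r i.
  by rewrite /u => ui; apply: d12; lia.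
have vneg (i : int) : v i -> b i - r i < 0.
  by rewrite /v => vi; apply: d34; lia.
have r'S (i : int) : 1 <= i <= m%:Z -> r' (i + 1) <= r' i.
  move=> im; rewrite !r'E; [|lia..].
  have ri : r (i + 1) <= r i by apply: pr; lia.
  (* Monotonicity of r' is at risk only at the last rows i1 - 1, t1 - 1, t2 of the three pieces of
     the column. At i1 - 1 the drop of r is strict: r_(i1-1) >= b_(i1-1) >= b_(i1) > r_(i1). *)
  have [ii1|ii1] := eqVneq i (i1 - 1).
    rewrite ii1 subrK.
    have := d1 (i1 - 1); have := d12 i1; have := pb (i1 - 1) i1; lia.
  have [it1|it1] := eqVneq i (t1 - 1).
    by move: ri; rewrite it1 subrK; lia.
  have [it2|it2] := eqVneq i t2; first by move: ri; rewrite it2; lia.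
  by lia.
split.
  (* The change of the partial sums of d. It vanishes from i4 on because I has exactly c - i1 + 1
     rows. *)
  pose T (k : int) := cnt i3 (t1 - 1) k + cnt t3 t2 k - cnt i1 c k.
  apply: (@profile_transfer m b r b' r' T u v i3 i4) => //; try lia.
  - by rewrite b'E ?bm; lia.
  - by rewrite r'E ?rm; lia.
  - by move=> i im; apply: dE; lia.
  - by rewrite /T !cnt_low; lia.
  - move=> i im; rewrite /T cntS (cntS t3) (cntS i1) /u /v; clear -t13 i3t1 t24 t32 c12 i12 i23; lia.
  - by move=> i im; rewrite /T !cnt_high; lia.
apply: (@weight_drop m b r b' r' c (i3 - 1)) => [||p pm]; try lia.
rewrite /wt.
have wE : b' p - b' (p + 1) = b p - b (p + 1) - (p == c)%:Z.
  by rewrite !b'E; lia.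
have w'_ge0 : 0 <= b p - b (p + 1) - (p == c)%:Z.
  by rewrite -wE; have := b'S p pm; lia.
have dp := dE p; have dp1 := dE (p + 1).
have -> : b' p - r' p = b p - r p - (u p)%:Z + (v p)%:Z by apply: dp; lia.
have -> : r' (p + 1) - b' (p + 1) =
    r (p + 1) - b (p + 1) - (v (p + 1))%:Z + (u (p + 1))%:Z.
  by move: dp1; lia.
have up := upos p; have up1 := upos (p + 1).
have vp := vneg p; have vp1 := vneg (p + 1).
have rp : r (p + 1) <= r p by apply: pr; lia.
have f_drop : (i3 < t1) && (p == i3 - 1) -> v (p + 1) /\ 0 <= b p - r p.
  by move=> /andP[lt_i3 /eqP ->]; split; [rewrite /v; lia | apply: d3; lia].
have c_drop : p == c -> u p by move=> /eqP ->; rewrite /u; lia.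
rewrite wE; apply: wt_step => //; clear -rp up1 vp1; lia.
Qed.

(* The first case of the B-step is t1 = t3 = i2, t2 = i2 - s + 1. *)
Lemma B_profile (m : nat) (b r b' r' : int -> int)
    (i1 i2 i3 i4 c t1 t2 t3 : int) :
  profile m b r -> blocks m (fun i => b i - r i) i1 i2 i3 i4 ->
  i3 <= c + 1 <= i4 ->
  (forall i : int, 1 <= i <= m%:Z + 1 -> b' i = b i - (i <= c)%R%:Z) ->
  (forall i : int, 1 <= i <= m%:Z -> b' (i + 1) <= b' i) ->
  (forall i : int, 1 <= i <= m%:Z + 1 ->
    r' i = r i - [|| i < t2, t3 < i <= t1 | i2 < i <= i4]%R%:Z) ->
  i1 <= t2 -> t2 <= t3 + 1 -> t3 <= t1 -> t1 <= i2 ->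
  t3 - t2 + 1 + (i2 - t1) = i4 - c ->
  (t1 < i2 -> r (t1 + 1) < r t1) -> r t2 < r (t2 - 1) ->
  profile m b' r' /\
  weight m b' r' + 1 + ((t1 < i2) || (t3 == i2))%R%:Z <= weight m b r.
Proof.
move=> prof [i1_gt1 i12 i23 i34 i4m d1 d12 d2 d3 d34 d4] c34 b'E b'S r'E.
move=> i1t2 t23 t31 t12 sE rt1 rt2.
have := prof => -[pb pr bm rm b1 _].
pose u (i : int) := (t2 <= i <= t3) || (t1 < i <= i2).
pose v (i : int) := c < i <= i4.
have dE (i : int) : 1 <= i <= m%:Z + 1 ->
    b' i - r' i = b i - r i - (u i)%:Z + (v i)%:Z.
  move=> im; rewrite b'E // r'E // /u /v.
  clear -c34 i23 i34 t31 t12 t23; lia.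
have upos (i : int) : u i -> 0 < b i - r i.
  by rewrite /u => ui; apply: d12; lia.
have vneg (i : int) : v i -> b i - r i < 0.
  by rewrite /v => vi; apply: d34; lia.
have r'S (i : int) : 1 <= i <= m%:Z -> r' (i + 1) <= r' i.
  move=> im; rewrite !r'E; [|lia..].
  have ri : r (i + 1) <= r i by apply: pr; lia.
  (* The critical rows are now i4, t1 and t2 - 1. At i4 the drop is strict: r_(i4) > b_(i4) >=
     b_(i4+1) >= r_(i4+1). *)
  have [ii4|ii4] := eqVneq i i4.
    rewrite ii4.
    have := d34 i4; have := pb i4 (i4 + 1); lia.
  have [it1|it1] := eqVneq i t1.
    by move: ri; rewrite it1; lia.
  have [it2|it2] := eqVneq i (t2 - 1).
    by move: ri; rewrite it2 subrK; lia.
  by lia.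
split.
  pose T (k : int) := cnt (c + 1) i4 k - cnt t2 t3 k - cnt (t1 + 1) i2 k.
  apply: (@profile_transfer m b r b' r' T u v i3 i4) => //; try lia.
  - by rewrite b'E ?bm; lia.
  - by rewrite r'E ?rm; lia.
  - by move=> i im; apply: dE; lia.
  - by rewrite /T !cnt_low; lia.
  - move=> i im; rewrite /T cntS (cntS t2) (cntS (t1 + 1)) /u /v.
    clear -t31; lia.
  - by move=> i im; rewrite /T !cnt_high; lia.
apply: (@weight_drop m b r b' r' c i2) => [||p pm]; try lia.
rewrite /wt.
have wE : b' p - b' (p + 1) = b p - b (p + 1) - (p == c)%:Z.
  by rewrite !b'E; lia.
have w'_ge0 : 0 <= b p - b (p + 1) - (p == c)%:Z.
  by rewrite -wE; have := b'S p pm; lia.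
have dp := dE p; have dp1 := dE (p + 1).
have -> : b' p - r' p = b p - r p - (u p)%:Z + (v p)%:Z by apply: dp; lia.
have -> : r' (p + 1) - b' (p + 1) =
    r (p + 1) - b (p + 1) - (v (p + 1))%:Z + (u (p + 1))%:Z.
  by move: dp1; lia.
have up := upos p; have up1 := upos (p + 1).
have vp := vneg p; have vp1 := vneg (p + 1).
have rp : r (p + 1) <= r p by apply: pr; lia.
have f_drop : ((t1 < i2) || (t3 == i2)) && (p == i2) ->
    u p /\ 0 <= r (p + 1) - b (p + 1).
  by move=> /andP[lt_i2 /eqP ->]; split; [rewrite /u; lia | lia].
have c_drop : p == c -> v (p + 1) by move=> /eqP ->; rewrite /v; lia.
(* The finalised column acts at row p + 1 = c + 1, hence on the second min, and p = i2 acts on the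
   first; so the two minima trade places. *)
rewrite wE [X in X + _ + _ <= _]addrC [leRHS]addrC.
apply: wt_step => //; clear -rp up1 vp1; lia.
Qed.

(** * Extremal indices in integer ranges and the sign blocks of d *)

Lemma irange_sorted (a b : int) : sorted <%R (irange a b).
Proof.
rewrite /irange; case: ifP => // _; rewrite sorted_map.
apply: sub_sorted (iota_ltn_sorted 0 _) => x y /=; lia.
Qed.

Lemma le_last_sorted (s : seq int) (x : int) :
  sorted <%R s -> x \in s -> x <= last 0 s.
Proof.
case: s => // y s /=; elim: s y x => [|z s IHs] y x /=.
  by rewrite inE => _ /eqP ->.
case/andP=> yz zs; rewrite inE => /predU1P[->|]; last exact: IHs.
by apply: le_trans (ltW yz) _; apply: IHs; rewrite ?mem_head.
Qed.

Lemma head_le_sorted (s : seq int) (x : int) :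
  sorted <%R s -> x \in s -> head 0 s <= x.
Proof.
case: s => // y s /= /(order_path_min lt_trans)/allP ys.
by rewrite inE => /predU1P[-> //|/ys/ltW].
Qed.

Lemma last_mem (T : eqType) (x0 x : T) (s : seq T) : x \in s -> last x0 s \in s.
Proof. by case: s => // y s _; rewrite /= mem_last. Qed.

Lemma head_mem (T : eqType) (x0 x : T) (s : seq T) : x \in s -> head x0 s \in s.
Proof. by case: s => // y s _; rewrite /= mem_head. Qed.

Lemma least_inP (a b : int) (P : pred int) (x : int) : a <= x <= b -> P x ->
  [/\ a <= least_in a b P <= b, P (least_in a b P) &
      forall z : int, a <= z < least_in a b P -> ~~ P z].
Proof.
move=> ab Px; set s := [seq i <- irange a b | P i].
have xs : x \in s by rewrite mem_filter mem_irange Px.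
have srt : sorted <%R s by apply: sorted_filter (irange_sorted _ _); apply: lt_trans.
rewrite -[least_in a b P]/(head 0 s).
have := head_mem _ 0 _ _ xs; rewrite mem_filter mem_irange => /andP[Py ay].
split=> // z az; apply/negP => Pz.
have zs : z \in s.
  case/andP: az ay => az zy /andP[_ yb].
  by rewrite mem_filter mem_irange Pz az (le_trans (ltW zy) yb).
have := head_le_sorted _ _ srt zs; rewrite leNgt => /negP; apply; by case/andP: az.
Qed.

Lemma greatest_inP (a b : int) (P : pred int) (x : int) : a <= x <= b -> P x ->
  [/\ a <= greatest_in a b P <= b, P (greatest_in a b P) &
      forall z : int, greatest_in a b P < z <= b -> ~~ P z].
Proof.
move=> ab Px; set s := [seq i <- irange a b | P i].
have xs : x \in s by rewrite mem_filter mem_irange Px.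
have srt : sorted <%R s by apply: sorted_filter (irange_sorted _ _); apply: lt_trans.
rewrite -[greatest_in a b P]/(last 0 s).
have := last_mem _ 0 _ _ xs; rewrite mem_filter mem_irange => /andP[Py ay].
split=> // z az; apply/negP => Pz.
have zs : z \in s.
  case/andP: az ay => yz zb /andP[ay _].
  by rewrite mem_filter mem_irange Pz zb (le_trans ay (ltW yz)).
have := le_last_sorted _ _ srt zs; rewrite leNgt => /negP; apply; by case/andP: az.
Qed.

(** The greatest index satisfying P ends a run, since P fails at m + 1, so z exists. A failure of P
    between y and z would end a run before z. *)
Lemma first_runP (m : nat) (P : pred int) (x : int) :
  1 <= x <= m%:Z -> P x -> ~~ P (m%:Z + 1) ->
  let y := least_in 1 m%:Z P in
  let z := least_in 1 m%:Z (fun i => P i && ~~ P (i + 1)) in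
  [/\ 1 <= y, y <= z, z <= m%:Z, forall i : int, y <= i <= z -> P i &
      ~~ P (z + 1) /\ forall i : int, 1 <= i < y -> ~~ P i].
Proof.
move=> xm Px Pm y z.
have [ym Py yP] := least_inP _ _ _ _ xm Px; rewrite -/y in ym Py yP.
have [gm Pg gP] := greatest_inP _ _ _ _ xm Px.
set g := greatest_in _ _ _ in gm Pg gP.
have PgS : P g && ~~ P (g + 1).
  rewrite Pg /=; have [->//|gNm] := eqVneq g m%:Z.
  by apply: gP; lia.
have [zm /andP[Pz PzS] zP] :=
  least_inP 1 m%:Z (fun i => P i && ~~ P (i + 1)) g gm PgS.
rewrite -/z in zm Pz PzS zP.
have yz : y <= z by rewrite leNgt; apply/negP => zy; have := yP z; rewrite Pz; lia.
split=> //; [lia | lia | move=> i /andP[yi iz]].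
apply: (@int_upward_ind (fun i => i <= z -> P i) y _ _ i yi iz) => // k yk IHk kz.
have Pk : P k by apply: IHk; lia.
by have := zP k; rewrite Pk /= negbK; apply; lia.
Qed.

(** The partial sums of d start and end at 0 and are never negative. Hence a nonzero d takes both
    signs, and the positive block comes first: otherwise the partial sum at i3 would be negative. *)
Lemma blocksP (m : nat) (b r : int -> int) (x : int) :
  let d i := b i - r i in
  profile m b r -> 1 <= x <= m%:Z -> d x != 0 ->
  blocks m d (least_in 1 m%:Z (fun i => 0 < d i))
             (least_in 1 m%:Z (fun i => (0 < d i) && (d (i + 1) <= 0)))
             (least_in 1 m%:Z (fun i => d i < 0))
             (least_in 1 m%:Z (fun i => (d i < 0) && (0 <= d (i + 1)))).
Proof.
move=> d prof xm dx.
have [S [S0 Sm SS Sge]] := prof_sum _ _ _ prof.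
have Sx := SS x xm; have Sx0 := Sge (x - 1).
have dm : d (m%:Z + 1) = 0.
  by rewrite /d (prof_bm _ _ _ prof) (prof_rm _ _ _ prof).
have d_1 : d 1 = 0 by rewrite /d (prof_1 _ _ _ prof); lia.
have [p pm dp] : exists2 p : int, 1 <= p <= m%:Z & 0 < d p.
  have [/hasP[p]|/hasPn npos] := boolP (has (fun i => 0 < d i) (irange 1 m%:Z)).
    by rewrite mem_irange => ? ?; exists p.
  have d_le0 (i : int) : 1 <= i <= m%:Z -> d i <= 0.
    by move=> im; rewrite leNgt; apply: npos; rewrite mem_irange.
  have := @sumint_ge S d 0 (x - 1); have := d_le0 x xm; have := Sge x.
  rewrite -/(d x) in Sx; move: dx => + Sxge dxle H.
  have : S (x - 1) <= S 0 by apply: H => [|i ?|i ?]; [lia|apply: SS|apply: d_le0]; lia.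
  by lia.
have [q qm dq] : exists2 q : int, 1 <= q <= m%:Z & d q < 0.
  have [/hasP[q]|/hasPn nneg] := boolP (has (fun i => d i < 0) (irange 1 m%:Z)).
    by rewrite mem_irange => ? ?; exists q.
  have d_ge0 (i : int) : 1 <= i <= m%:Z -> 0 <= d i.
    by move=> im; rewrite leNgt; apply: nneg; rewrite mem_irange.
  have H := @sumint_le S d x m%:Z; have := d_ge0 x xm.
  rewrite -/(d x) in Sx; move: dx => + dxge.
  have : S x <= S m%:Z by apply: H => [|i ?|i ?]; [lia|apply: SS|apply: d_ge0]; lia.
  by lia.
have := first_runP m (fun i => 0 < d i) p pm dp; rewrite /= dm ltxx.
have -> : least_in 1 m%:Z (fun i => (0 < d i) && ~~ (0 < d (i + 1))) =
          least_in 1 m%:Z (fun i => (0 < d i) && (d (i + 1) <= 0)).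
  by congr head; apply: eq_filter => i; rewrite -leNgt.
set i1 := least_in _ _ _; set i2 := least_in _ _ _.
case=> // i1_ge1 i12 i2m d12 [d2 d1].
have := first_runP m (fun i => d i < 0) q qm dq; rewrite /= dm ltxx.
have -> : least_in 1 m%:Z (fun i => (d i < 0) && ~~ (d (i + 1) < 0)) =
          least_in 1 m%:Z (fun i => (d i < 0) && (0 <= d (i + 1))).
  by congr head; apply: eq_filter => i; rewrite -leNgt.
set i3 := least_in _ _ _; set i4 := least_in _ _ _.
case=> // i3_ge1 i34 i4m d34 [d4 d3].
have di1 := d12 i1; have di3 := d34 i3.
have i13 : i1 < i3.
  rewrite ltNge; apply/negP => i31.
  have i3N1 : i3 != i1 by apply/eqP => E; move: di1 di3; rewrite E; lia.
  have Si3 := SS i3; have := Sge i3; rewrite -/(d i3) in Si3.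
  have : S (i3 - 1) <= S 0.
    apply: (@sumint_ge S d) => [|i ?|i ?]; first lia.
      by apply: SS; lia.
    by rewrite leNgt; apply: d1; lia.
  by lia.
split=> //.
- rewrite lt_neqAle i1_ge1 andbT; apply/eqP => E; move: di1; rewrite -E d_1; lia.
- rewrite ltNge; apply/negP => i32; have := d12 i3; lia.
- by move=> i ?; rewrite leNgt; apply: d1.
- by rewrite leNgt.
- by move=> i ?; rewrite leNgt; apply: d3.
- by rewrite leNgt.
Qed.

(** * States of the procedure and the A-step *)

Section State.

Variables (m : nat) (c : int -> int).
Implicit Type st : state.

Local Notation b_of := (b_of m c).
Local Notation r_of := (r_of m).

Lemma b_of_in st (i : int) : 1 <= i <= m%:Z ->
  b_of st i = (count (fun j => i <= c j) (rem_cols st))%:Z.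
Proof. by move=> im; rewrite /Defs.b_of /on_rows im. Qed.

Lemma b_of_out st : b_of st (m%:Z + 1) = 0.
Proof. by rewrite /Defs.b_of /on_rows ifF //; lia. Qed.

Lemma r_of_out st : r_of st (m%:Z + 1) = 0.
Proof. by rewrite /Defs.r_of /on_rows ifF //; lia. Qed.

Lemma b_of_antitone st (i : int) : 1 <= i <= m%:Z ->
  b_of st (i + 1) <= b_of st i.
Proof.
move=> im; rewrite [leRHS]b_of_in //; have [->|iNm] := eqVneq i m%:Z.
  by rewrite b_of_out; lia.
rewrite b_of_in; last lia.
rewrite lez_nat; apply: sub_count => j /=; lia.
Qed.

(** b_p - b_(p+1) counts the remaining columns of sum p. This provides a candidate for the column
    that a step selects. *)
Lemma col_exists st (p : int) : 1 <= p < m%:Z ->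
  b_of st (p + 1) < b_of st p -> exists2 k, k \in rem_cols st & c k = p.
Proof.
move=> pm; rewrite !b_of_in; [|lia..] => ltb.
have [/hasP[k kJ /eqP]|/hasPn noc] :=
  boolP (has (fun k => c k == p) (rem_cols st)); first by exists k.
move: ltb; rewrite (@eq_in_count _ _ (fun j => p <= c j)) ?ltxx // => k /noc /=.
by lia.
Qed.

Lemma size_rem_cols_finalise st (j : int) (col : seq int) :
  uniq (rem_cols st) -> j \in rem_cols st ->
  size (rem_cols st) = (size (rem_cols (finalise st (j, col)))).+1.
Proof.
move=> uJ jJ; rewrite /= -rem_filter // size_rem //.
by case: (rem_cols st) jJ.
Qed.

Lemma b_of_finalise st (j : int) (col : seq int) :
  uniq (rem_cols st) -> j \in rem_cols st -> c j <= m%:Z ->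
  forall i : int, 1 <= i <= m%:Z + 1 ->
  b_of (finalise st (j, col)) i = b_of st i - (i <= c j)%R%:Z.
Proof.
move=> uJ jJ cm i im; have [->|iNm] := eqVneq i (m%:Z + 1).
  by rewrite !b_of_out; lia.
rewrite !b_of_in; [|lia..].
rewrite [count _ (rem_cols st)](permP (perm_to_rem jJ)) /= -rem_filter //.
by lia.
Qed.

Lemma r_of_finalise st (j : int) (col : seq int) :
  (forall i : int, i \in col -> i <= m%:Z) ->
  forall i : int, 1 <= i <= m%:Z + 1 ->
  r_of (finalise st (j, col)) i = r_of st i - (i \in col)%:Z.
Proof.
move=> colm i im; have [->|iNm] := eqVneq i (m%:Z + 1).
  have colN : (m%:Z + 1 \in col) = false by apply/negP => /colm; lia.
  by rewrite !r_of_out colN subr0.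
have im' : 1 <= i <= m%:Z by lia.
by rewrite /Defs.r_of /on_rows im' /= natz.
Qed.

Definition weight_of st : int := weight m (b_of st) (r_of st).

Definition mem_segs (segs : seq (int * int)) (i : int) : bool :=
  has (fun t => t.1 <= i <= t.2) segs.

(** A segment is a pair (first row, last row), empty if the order is reversed. The last clause is
    the amortised cost of the step; [1 < size segs] later shows that a state that is not stopped has
    weight at least 1. *)
Definition good_step st (jcol : int * seq int) : Prop :=
  exists segs : seq (int * int),
  [/\ jcol.1 \in rem_cols st, forall i : int, (i \in jcol.2) = mem_segs segs i,
      profile m (b_of (finalise st jcol)) (r_of (finalise st jcol)),
      (1 < size segs)%N &
      (size segs)%:Z + weight_of (finalise st jcol) <=
        weight_of st + (~~ stopped m c (finalise st jcol))%:Z].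

Lemma not_stopped st (x : int) : 1 <= x <= m%:Z ->
  b_of st x - r_of st x != 0 -> ~~ stopped m c st.
Proof.
by move=> xm dx; apply/allPn; exists x; rewrite ?mem_irange.
Qed.

Lemma A_step_good st (i1 i2 i3 i4 : int) :
  i1 = i1_of m c st -> i2 = i2_of m c st ->
  i3 = i3_of m c st -> i4 = i4_of m c st ->
  uniq (rem_cols st) -> profile m (b_of st) (r_of st) ->
  blocks m (fun i => b_of st i - r_of st i) i1 i2 i3 i4 ->
  i2 - i1 <= i4 - i3 -> good_step st (A_step m c st).
Proof.
move=> i1E i2E i3E i4E uJ prof blk i_le.
have := prof => -[pb pr bm rm b1 _].
have := blk => -[i1_gt1 i12 i23 i34 i4m d1 d12 d2 d3 d34 d4].
rewrite /A_step /Rplus -i1E -i2E -i3E.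
set J := [seq j <- _ | _]; set j := last 0 J.
have [jJ cj] : j \in rem_cols st /\ i1 <= c j <= i2.
  (* Here b_(i2) > r_(i2) >= r_(i2+1) >= b_(i2+1), so some column has sum i2 in R^+ and [last] does
     not return its default. *)
  have [||k kJ ck] := @col_exists st i2; first lia.
    have := d12 i2; have := pr i2 (i2 + 1); lia.
  have : k \in J by rewrite mem_filter mem_irange ck kJ; lia.
  by move/(last_mem _ 0); rewrite mem_filter mem_irange => /andP[].
set s := c j - i1 + 1; cbv zeta.
set r := r_of st in pr rm b1 d1 d12 d2 d3 d34 d4 prof blk *.
have key (I : seq int) (t1 t2 t3 : int) :
    (forall i : int, (i \in I) = (i3 <= i < t1) || (t3 <= i <= t2)) ->
    i3 <= t1 -> t1 <= t3 -> t3 <= t2 + 1 -> t2 <= i4 ->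
    t1 - i3 + (t2 - t3 + 1) = s ->
    (i3 < t1 -> r t1 < r (t1 - 1)) -> r (t2 + 1) < r t2 ->
    let st' := finalise st (j, irange 1 (i1 - 1) ++ I) in
    [/\ profile m (b_of st') (r_of st'),
        weight_of st' + 1 + (i3 < t1)%R%:Z <= weight_of st
      & t1 < t3 -> t1 <= i4 -> ~~ stopped m c st'].
  move=> IE i3t1 t13 t32 t24 sE rt1 rt2 st'.
  have b'E := @b_of_finalise st j (irange 1 (i1 - 1) ++ I) uJ jJ.
  have r'E (i : int) : 1 <= i <= m%:Z + 1 ->
      r_of st' i = r i - [|| i < i1, i3 <= i < t1 | t3 <= i <= t2]%R%:Z.
    move=> im; rewrite r_of_finalise // ?mem_cat ?mem_irange ?IE -/r.
      by congr (_ - _%:Z); rewrite (_ : 1 <= i <= i1 - 1 = (i < i1)) //; lia.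
    by move=> k; rewrite mem_cat mem_irange IE; lia.
  have [||p w] := @A_profile m (b_of st) r (b_of st') (r_of st') i1 i2 i3 i4
    (c j) t1 t2 t3 prof blk cj _ _ r'E i3t1 t13 t32 t24 sE rt1 rt2.
  - by move=> i im; apply: b'E; lia.
  - by move=> i im; apply: b_of_antitone.
  (* Row t1 lies beyond c_j and outside the new column, so d_(t1) is unchanged and still
     negative. *)
  split=> // t13' t14; apply: (@not_stopped _ t1); first lia.
  rewrite r'E ?b'E; [|lia..].
  have := d34 t1; lia.
rewrite /good_step; case: ifP => r_drop.
  (* The interval t3..t2 is empty here, and i3 < t1 gives a drop of 2, which pays for both
     segments. *)
  exists [:: (1, i1 - 1); (i3, i3 + s - 1)].
  have [||||||||p w _] := key (irange i3 (i3 + s - 1))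
    (i3 + s) (i3 + s - 1) (i3 + s); try lia.
  - by move=> i; rewrite mem_irange; lia.
  - by rewrite subrK.
  split; [exact: jJ | | exact: p | by [] | by move: w; rewrite /=; lia].
  by move=> i; rewrite /= mem_cat !mem_irange /mem_segs /= orbF.
set t1 := least_in i3 _ _; set t2 := least_in (i3 + s) _ _.
set t3 := t2 + t1 - i3 - s + 1.
have d_s := d34 (i3 + s - 1).
have b_s := pb (i3 + s - 1) (m%:Z + 1).
have r_s := pr (i3 + s - 1) (i3 + s).
(* Otherwise row i3 + s is row m + 1, of sum 0, while r > b >= 0 at row i3 + s - 1 of R^-; this
   contradicts [r_drop]. *)
have is_m : i3 + s <= m%:Z.
  rewrite leNgt; apply/negP => sm.
  have E : i3 + s = m%:Z + 1 by lia.
  have rE : r (i3 + s) = 0 by rewrite E.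
  by lia.
have [|//|t1b /eqP rt1 t1_min] := @least_inP i3 (i3 + s - 1)
  (fun t => r t == r (i3 + s - 1)) (i3 + s - 1); first lia.
rewrite -/t1 in t1b rt1 t1_min.
(* The last row g with this row sum is a witness for t2; if g = m, the strict drop comes from
   r_(m+1) = 0. *)
have [||g_b /eqP rg g_max] := @greatest_inP (i3 + s) m%:Z
  (fun t => r t == r (i3 + s - 1)) (i3 + s); [lia..|].
set g := greatest_in _ _ _ in g_b rg g_max.
have [||t2b /andP[/eqP rt2 rt2S] _] := @least_inP (i3 + s) m%:Z
  (fun t => (r t == r (i3 + s - 1)) && (r (t + 1) < r (i3 + s - 1))) g; first lia.
  rewrite rg eqxx /=; have [->|gNm] := eqVneq g m%:Z; first by rewrite rm; lia.
  have := g_max (g + 1); have := pr g (g + 1); lia.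
rewrite -/t2 in t2b rt2 rt2S.
(* If t2 > i4, then r is constant from i3 + s - 1 to i4 + 1 while b does not increase, so d_(i4+1)
   would be negative. *)
have t24 : t2 <= i4.
  rewrite leNgt; apply/negP => i4t2.
  have := pr (i3 + s - 1) (i4 + 1); have := pr (i4 + 1) t2.
  have := pb (i3 + s - 1) (i4 + 1); lia.
have [||||||||p w ns] := key (irange i3 (t1 - 1) ++ irange t3 t2) t1 t2 t3.
- by move=> i; rewrite mem_cat !mem_irange; lia.
- lia.
- by rewrite /t3; lia.
- by rewrite /t3; lia.
- lia.
- by rewrite /t3; lia.
- move=> i3t1; have := t1_min (t1 - 1); have := pr (t1 - 1) t1; lia.
- by rewrite rt2.
have {}ns := ns _ _; rewrite ns; [|rewrite /t3; lia|lia].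
(* As the new state is not stopped, the allowance is 2 segments, plus 1 if i3 < t1. If t1 = i3, the
   piece i3..t1-1 is empty and two suffice. *)
have [t1E|t1N] := eqVneq t1 i3.
  exists [:: (1, i1 - 1); (t3, t2)].
  split; [exact: jJ | | exact: p | by [] | by move: w; rewrite /=; lia].
  move=> i; rewrite /= !mem_cat !mem_irange /mem_segs /= orbF.
  by congr (_ || _); rewrite t1E; lia.
exists [:: (1, i1 - 1); (i3, t1 - 1); (t3, t2)].
split; [exact: jJ | | exact: p | by [] | by move: w; rewrite /=; lia].
by move=> i; rewrite /= !mem_cat !mem_irange /mem_segs /= orbF.
Qed.

End State.

(** * The B-step *)

Section BStep.
Variables (m : nat) (c : int -> int).
Local Notation b_of := (b_of m c).
Local Notation r_of := (r_of m).
Implicit Type st : state.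

Lemma B_step_good st (i1 i2 i3 i4 : int) :
  i1 = i1_of m c st -> i2 = i2_of m c st ->
  i3 = i3_of m c st -> i4 = i4_of m c st ->
  uniq (rem_cols st) -> profile m (b_of st) (r_of st) ->
  blocks m (fun i => b_of st i - r_of st i) i1 i2 i3 i4 ->
  i4 - i3 < i2 - i1 -> good_step m c st (B_step m c st).
Proof.
move=> i1E i2E i3E i4E uJ prof blk i_le.
have := prof => -[pb pr bm rm b1 _].
have := blk => -[i1_gt1 i12 i23 i34 i4m d1 d12 d2 d3 d34 d4].
rewrite /B_step /Rminus -i2E -i3E -i4E.
set J := [seq j <- _ | _]; set j := head 0 J.
have [jJ cj] : j \in rem_cols st /\ i3 <= c j + 1 <= i4.
  (* Here b_(i3-1) >= r_(i3-1) >= r_(i3) > b_(i3), so some column has sum i3 - 1 and [head] does not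
     return its default. *)
  have [||k kJ ck] := @col_exists m c st (i3 - 1); first lia.
    rewrite subrK; have := d3 (i3 - 1); have := d34 i3; have := pr (i3 - 1) i3.
    by lia.
  have : k \in J by rewrite mem_filter mem_irange ck kJ; lia.
  by move/(head_mem _ 0); rewrite mem_filter mem_irange => /andP[].
set s := i4 - c j; cbv zeta.
set r := r_of st in pr rm b1 d1 d12 d2 d3 d34 d4 prof blk *.
pose col I := [seq i <- irange 1 (c j) | i \notin (I : seq int)] ++ irange (c j + 1) i4.
(* Since i2 <= c_j, the rows i2+1..c_j left after removing I join c_j+1..i4 into a single
   segment. *)
have colE (I : seq int) (t1 t2 t3 : int) :
    (forall i : int, (i \in I) = (t2 <= i <= t3) || (t1 < i <= i2)) ->
    i1 <= t2 -> t2 <= t3 + 1 -> t3 <= t1 -> t1 <= i2 ->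
    forall i : int, (i \in col I) =
      (1 <= i) && [|| i < t2, t3 < i <= t1 | i2 < i <= i4].
  move=> IE i1t2 t23 t31 t12 i.
  by rewrite /col mem_cat mem_filter !mem_irange IE; lia.
have key (I : seq int) (t1 t2 t3 : int) :
    (forall i : int, (i \in I) = (t2 <= i <= t3) || (t1 < i <= i2)) ->
    i1 <= t2 -> t2 <= t3 + 1 -> t3 <= t1 -> t1 <= i2 ->
    t3 - t2 + 1 + (i2 - t1) = s ->
    (t1 < i2 -> r (t1 + 1) < r t1) -> r t2 < r (t2 - 1) ->
    let st' := finalise st (j, col I) in
    [/\ profile m (b_of st') (r_of st'),
        weight_of m c st' + 1 + ((t1 < i2) || (t3 == i2))%R%:Z <=
          weight_of m c st
      & t3 < t1 -> ~~ stopped m c st'].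
  move=> IE i1t2 t23 t31 t12 sE rt1 rt2 st'.
  have colIE := colE I t1 t2 t3 IE i1t2 t23 t31 t12.
  have b'E := @b_of_finalise m c st j (col I) uJ jJ.
  have r'E (i : int) : 1 <= i <= m%:Z + 1 ->
      r_of st' i = r i - [|| i < t2, t3 < i <= t1 | i2 < i <= i4]%R%:Z.
    move=> im; rewrite r_of_finalise // ?colIE -/r.
      by rewrite (_ : 1 <= i = true) //; lia.
    by move=> k; rewrite colIE; lia.
  have [||p w] := @B_profile m (b_of st) r (b_of st') (r_of st') i1 i2 i3 i4
    (c j) t1 t2 t3 prof blk cj _ _ r'E i1t2 t23 t31 t12 sE rt1 rt2.
  - by move=> i im; apply: b'E; lia.
  - by move=> i im; apply: b_of_antitone.
  (* Row t1 lies in the new column and t1 <= c_j, so b and r both lose 1 there and d_(t1) stays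
     positive. *)
  split=> // t31'; apply: (@not_stopped _ _ _ t1); first lia.
  rewrite r'E ?b'E; [|lia..].
  have := d12 t1; lia.
have size_le (segs : seq (int * int)) (I : seq int) :
    (size segs)%:Z + weight_of m c (finalise st (j, col I)) <=
      weight_of m c st + (~~ stopped m c (finalise st (j, col I)))%:Z ->
    let jcol := (j, [seq i <- irange 1 (c j) | i \notin I] ++ irange (c j + 1) i4) in
    (size segs)%:Z + weight_of m c (finalise st jcol) <=
      weight_of m c st + (~~ stopped m c (finalise st jcol))%:Z by [].
rewrite /good_step; case: ifP => r_drop.
  exists [:: (1, i2 - s); (i2 + 1, i4)].
  have IE (i : int) : (i \in irange (i2 - s + 1) i2) =
      (i2 - s + 1 <= i <= i2) || (i2 < i <= i2) by rewrite mem_irange; lia.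
  have [|||||||p w _] := key _ i2 (i2 - s + 1) i2 IE; try lia.
    by rewrite addrK.
  split; [exact: jJ | | exact: p | by [] | apply: size_le; rewrite [size _]/=; lia].
  move=> i; rewrite [_.2]/= -/(col _) (colE _ _ _ _ IE); try lia.
  by rewrite /mem_segs /=; lia.
set t1 := greatest_in _ i2 _; set t2 := least_in 1 (i2 - s) _.
set t3 := t2 + s - 1 - (i2 - t1).
have d_s := d12 (i2 - s + 1).
have r_s := pr (i2 - s) (i2 - s + 1).
have [|//|t1b /eqP rt1 t1_max] := @greatest_inP (i2 - s + 1) i2
  (fun t => r t == r (i2 - s + 1)) (i2 - s + 1); first lia.
rewrite -/t1 in t1b rt1 t1_max.
have [||g_b /eqP rg g_min] := @least_inP 1 (i2 - s)
  (fun t => r t == r (i2 - s + 1)) (i2 - s); [lia..|].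
set g := least_in _ _ _ in g_b rg g_min.
(* The value of r at row 0 is the default 0, so the comparison with row g - 1 requires g > 1. Row 1
   is excluded: r_1 = b_1 >= b > r at row i2 - s + 1. *)
have g_gt1 : 1 < g.
  rewrite ltNge; apply/negP => g1; have gE : g = 1 by lia.
  by move: rg; rewrite gE; have := pb 1 (i2 - s + 1); lia.
have [||t2b /andP[rt2S /eqP rt2] _] := @least_inP 1 (i2 - s)
  (fun t => (r t < r (t - 1)) && (r t == r (i2 - s + 1))) g; first lia.
  rewrite rg eqxx andbT.
  have := g_min (g - 1); have := pr (g - 1) g; lia.
rewrite -/t2 in t2b rt2 rt2S.
(* If t2 < i1, then row i1 - 1 has the row sum of row i2 - s + 1, which is below b there and hence
   below b_(i1-1), contrary to d_(i1-1) <= 0. *)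
have i1t2 : i1 <= t2.
  rewrite leNgt; apply/negP => t2i1.
  have := pr t2 (i1 - 1); have := pr (i1 - 1) (i2 - s + 1).
  have := pb (i1 - 1) (i2 - s + 1); have := d1 (i1 - 1); lia.
have IE (i : int) : (i \in irange t2 t3 ++ irange (t1 + 1) i2) =
    (t2 <= i <= t3) || (t1 < i <= i2) by rewrite mem_cat !mem_irange; lia.
have t23 : t2 <= t3 + 1 by rewrite /t3; lia.
have t31 : t3 < t1 by rewrite /t3; lia.
have [|||||||p w ns] := key _ t1 t2 t3 IE; try lia.
- move=> t1i2; have := t1_max (t1 + 1); have := pr t1 (t1 + 1); lia.
have {}ns := ns t31.
have colIE := colE _ _ _ _ IE i1t2 t23 (ltW t31).
(* For t1 = i2 the segments t3+1..t1 and i2+1..i4 merge. Otherwise i2 is in I, and the second drop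
   pays for the third segment. *)
have [t1E|t1N] := eqVneq t1 i2.
  exists [:: (1, t2 - 1); (t3 + 1, i4)].
  split; [exact: jJ | | exact: p | by [] |].
    by move=> i; rewrite [_.2]/= -/(col _) colIE /mem_segs /=; lia.
  by apply: size_le; rewrite [size _]/= ns; lia.
exists [:: (1, t2 - 1); (t3 + 1, t1); (i2 + 1, i4)].
split; [exact: jJ | | exact: p | by [] |].
  by move=> i; rewrite [_.2]/= -/(col _) colIE /mem_segs /=; lia.
by apply: size_le; rewrite [size _]/= ns; lia.
Qed.

End BStep.

(** * Covers by vertical segments and the bound on L_h *)

Lemma irange_uniq (a b : int) : uniq (irange a b).
Proof. by apply: sorted_uniq (irange_sorted a b); [apply: lt_trans | apply: ltxx]. Qed.

Lemma size_irange (a b : int) : a <= b + 1 -> (size (irange a b))%:Z = b - a + 1.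
Proof.
by rewrite /irange; case: ifP => ab abS; rewrite ?size_map ?size_iota /=; lia.
Qed.


Definition covered (L : seq (int * int * int)) (p : point) : bool :=
  has (fun t => (t.1.1 <= p.1 <= t.1.2) && (p.2 == t.2)) L.

(** A neighbour outside F lies outside the segment covering the point of F, so that point is an end
    of the segment, and the pair is one of the two listed in [ends]. *)
Lemma Lh_le (F : {fset point}) (L : seq (int * int * int)) :
  (forall p, (p \in F) = covered L p) -> (Lh F <= 2 * size L)%N.
Proof.
move=> FL.
pose ends (t : int * int * int) : seq (point * point) :=
  [:: ((t.1.1, t.2), (t.1.1 - 1, t.2)); ((t.1.2, t.2), (t.1.2 + 1, t.2))].
pose E := flatten [seq ends t | t <- L].
have sE : size E = (2 * size L)%N.
  by rewrite /E; elim: (L) => //= t l ->; lia.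
rewrite -sE; apply: (@leq_trans #|` [fset x in E]%fset|%fset); last first.
  by rewrite card_fseq size_undup.
apply: fsubset_leq_card; apply/fsubsetP => -[[i j] [i' j']].
rewrite in_hboundary in_fset /= => /and4P[di /eqP <-]; rewrite !FL.
case/hasP => t tL /andP[/= ti /eqP jt] /hasPn /(_ t tL) /=; rewrite jt eqxx andbT.
move=> ti'; apply/flattenP; exists (ends t); first exact: map_f.
rewrite !inE !xpair_eqE !eqxx !andbT; lia.
Qed.

(** * The segment budget along the procedure *)

Section Main.
Variables (m n : nat) (c : int -> int).
Implicit Type st : state.

Lemma weight_ge0 st : 0 <= weight_of m c st.
Proof.
rewrite /weight_of /weight big_nat; apply: sumr_ge0 => p pm.
have := @b_of_antitone m c st p; rewrite /wt; lia.
Qed.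

(** The invariant of [step]: each remaining column is charged one segment in advance, and one extra
    unit is lent until the procedure stops. *)
Definition segment_budget st : Prop :=
  [/\ uniq (rem_cols st), profile m (b_of m c st) (r_of m st) &
      exists L, (forall p, (p \in fin_pts st) = covered L p) /\
        (size L + size (rem_cols st))%:Z + weight_of m c st <=
          (2 * n)%:Z - 2 + (~~ stopped m c st)%:Z].

Lemma unstopped_good_step st :
  uniq (rem_cols st) -> profile m (b_of m c st) (r_of m st) ->
  ~~ stopped m c st ->
  exists2 jcol, good_step m c st jcol & step m c st = finalise st jcol.
Proof.
move=> uJ prof; rewrite /step => /[dup] /allPn[x + dx] /negbTE ->.
rewrite mem_irange => xm.
have blk := blocksP _ _ _ _ prof xm dx.
have [i1_gt1 i12 i23 i34 i4m _ _ _ _ _ _] := blk.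
have sp : (size (Rplus m c st))%:Z = i2_of m c st - i1_of m c st + 1.
  by apply: size_irange; apply: le_trans i12 _; rewrite lerDl.
have sm : (size (Rminus m c st))%:Z = i4_of m c st - i3_of m c st + 1.
  by apply: size_irange; apply: le_trans i34 _; rewrite lerDl.
case: leqP => s_le.
  exists (A_step m c st) => //.
  by apply: (A_step_good _ _ _ _ _ _ _ erefl erefl erefl erefl uJ prof blk); lia.
exists (B_step m c st) => //.
by apply: (B_step_good _ _ _ _ _ _ _ erefl erefl erefl erefl uJ prof blk); lia.
Qed.

Lemma segment_budget_step st : segment_budget st -> segment_budget (step m c st).
Proof.
move=> ist; have [uJ prof [L [FL sL]]] := ist.
have [st_stop|st_go] := boolP (stopped m c st).
  by rewrite /step st_stop.
have [[j col] [segs [jJ colE prof' _ w]] ->] := unstopped_good_step _ uJ prof st_go.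
split=> //; first exact: filter_uniq.
exists (L ++ [seq (t, j) | t <- segs]); split.
  move=> [i k]; rewrite mem_cat FL /covered has_cat; congr (_ || _).
  rewrite has_map /=.
  apply/mapP/hasP => [[i' + [-> ->]]|[t tS /andP[/= ti /eqP ->]]].
    rewrite colE => /hasP[t tS ti]; exists t => //=; by rewrite ti eqxx.
  by exists i => //; rewrite colE; apply/hasP; exists t.
have := size_rem_cols_finalise _ j col uJ jJ.
rewrite size_cat size_map; move: w sL; rewrite st_go; lia.
Qed.

(** The lent unit is always covered by the weight: a state that is not stopped admits a step with at
    least two segments, and the weight after it is nonnegative, so the weight before it is at least
    1. *)
Lemma segment_budget_segments st : segment_budget st ->
  exists2 L, (forall p, (p \in fin_pts st ++
                         [seq (i, j) | j <- rem_cols st, i <- irange 1 (c j)])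
                        = covered L p)
           & (size L <= 2 * n - 2)%N.
Proof.
move=> [uJ prof [L [FL sL]]].
exists (L ++ [seq (1, c j, j) | j <- rem_cols st]).
  move=> [i k]; rewrite mem_cat FL /covered has_cat; congr (_ || _).
  rewrite has_map.
  apply/allpairsPdep/hasP => [[j [i' [jJ + [-> ->]]]]|[j jJ /= /andP[ij /eqP ->]]].
    by rewrite mem_irange => ij; exists j => //=; rewrite ij eqxx.
  by exists j, i; rewrite mem_irange.
have w0 := weight_ge0 st.
have w1 : (~~ stopped m c st)%:Z <= weight_of m c st.
  have [//|st_go] := boolP (stopped m c st).
  have [jcol [segs [_ _ _ s_gt w]] _] := unstopped_good_step _ uJ prof st_go.
  have := weight_ge0 (finalise st jcol).
  by move: w; case: (stopped _ _ (finalise _ _)) => /=; lia.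
by rewrite size_cat size_map; lia.
Qed.

(** Each term of Phi with p < m is at most w_p and the last one vanishes, so Phi telescopes to at
    most b_1 - b_m <= n - 1. *)
Lemma segment_budget_init st : profile m (b_of m c st) (r_of m st) ->
  rem_cols st = irange 1 n%:Z -> fin_pts st = [::] -> (0 < m)%N -> (2 <= n)%N ->
  c 1 = m%:Z -> segment_budget st.
Proof.
move=> prof Jst Fst m_gt0 n_ge2 c1; split=> //.
  by rewrite Jst irange_uniq.
exists [::]; rewrite Fst; split=> //.
have sJ : (size (rem_cols st))%:Z = n%:Z by rewrite Jst size_irange; lia.
have [st_stop|st_go] := boolP (stopped m c st).
  (* With weight 0 the bound reads n <= 2n - 2, which is where n >= 2 enters. *)
  suff -> : weight_of m c st = 0 by move: sJ => /=; lia.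
  rewrite /weight_of /weight big_nat big1 // => p pm.
  have d0 (i : int) : 1 <= i <= m%:Z + 1 -> b_of m c st i = r_of m st i.
    move=> im; have [->|iNm] := eqVneq i (m%:Z + 1).
      by rewrite b_of_out r_of_out.
    apply/eqP; rewrite -subr_eq0; apply: (allP st_stop).
    by rewrite mem_irange; lia.
  have := @b_of_antitone m c st p; rewrite /wt !d0; lia.
have [S [S0 Sm SS Sge]] := prof_sum _ _ _ prof.
have wt_le (p : nat) : (1 <= p < m)%N ->
    wt (b_of m c st) (r_of m st) p%:Z <= b_of m c st p%:Z - b_of m c st p.+1%:Z.
  move=> pm; have -> : p.+1%:Z = p%:Z + 1 by lia.
  have := @b_of_antitone m c st p%:Z.
  have := prof_r _ _ _ prof p%:Z (p%:Z + 1).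
  rewrite /wt; lia.
(* d_m = S m - S (m - 1) = - S (m - 1) <= 0, and d_(m+1) = 0. *)
have wtm : wt (b_of m c st) (r_of m st) m%:Z = 0.
  have := SS m%:Z; have := Sge (m%:Z - 1); have := @b_of_antitone m c st m%:Z.
  rewrite /wt b_of_out r_of_out Sm; lia.
have b1 : b_of m c st 1 <= n%:Z.
  rewrite b_of_in; last lia.
  by rewrite -sJ lez_nat count_size.
have bm : 1 <= b_of m c st m%:Z.
  rewrite b_of_in; last lia.
  rewrite lez_nat -has_count; apply/hasP; exists 1; rewrite ?Jst ?mem_irange ?c1; lia.
have : weight_of m c st <= b_of m c st 1 - b_of m c st m%:Z.
  rewrite /weight_of /weight big_nat_recr //= wtm addr0.
  have tel := @telescope_sumr int 1 m (fun k => - b_of m c st k%:Z) m_gt0.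
  have -> : b_of m c st 1 - b_of m c st m%:Z =
      - b_of m c st m%:Z - - b_of m c st 1%N%:Z by rewrite opprK addrC.
  rewrite -tel.
  rewrite big_nat [leRHS]big_nat; apply: ler_sum => p pm.
  by rewrite opprK addrC; apply: wt_le.
by move: sJ => /=; lia.
Qed.

End Main.

(** * Row and column counts, and the initial profile from consistency *)

Lemma count_irangeS (P : pred int) (k : int) : 1 <= k ->
  (count P (irange 1 k))%:Z = (count P (irange 1 (k - 1)))%:Z + (P k)%:Z.
Proof.
move=> k1; have /permP -> : perm_eq (irange 1 k) (k :: irange 1 (k - 1)).
  apply: uniq_perm; rewrite /= ?irange_uniq ?mem_irange ?andbT //; first lia.
  by move=> i; rewrite inE !mem_irange; lia.
by rewrite /= addnC PoszD.
Qed.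

Lemma count_irange_le (P : pred int) (k l : int) : 0 <= k -> k <= l ->
  (count P (irange 1 k))%:Z <= (count P (irange 1 l))%:Z.
Proof.
move=> k0 kl; apply: (@sumint_le (fun k => (count P (irange 1 k))%:Z)
  (fun k => (P k)%:Z)) => // i ik.
by apply: count_irangeS; lia.
Qed.

Section Consistency.
Variables (m n : nat) (F : {fset point}).
Hypothesis F_box : forall p, p \in F -> (1 <= p.1 <= m%:Z) && (1 <= p.2 <= n%:Z).

Lemma col_sumE (j : int) :
  col_sum F j = count (fun i => (i, j) \in F) (irange 1 m%:Z).
Proof.
rewrite /col_sum -size_filter -[RHS](size_map (fun i => (i, j))).
set s := map _ _; have us : uniq s.
  by rewrite map_inj_uniq ?filter_uniq ?irange_uniq // => x y [].
rewrite -(undup_id us) -card_fseq; congr #|` _|%fset.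
apply/fsetP => -[i k]; rewrite !in_fset !inE /=.
apply/andP/mapP => [[iF /eqP kj]|[i' + [-> ->]]].
  exists i; last by rewrite kj.
  by rewrite mem_filter mem_irange -kj iF; have /andP[] := F_box _ iF.
by rewrite mem_filter => /andP[].
Qed.

Lemma row_sumE (i : int) :
  row_sum F i = count (fun j => (i, j) \in F) (irange 1 n%:Z).
Proof.
rewrite /row_sum -size_filter -[RHS](size_map (fun j => (i, j))).
set s := map _ _; have us : uniq s.
  by rewrite map_inj_uniq ?filter_uniq ?irange_uniq // => x y [].
rewrite -(undup_id us) -card_fseq; congr #|` _|%fset.
apply/fsetP => -[k j]; rewrite !in_fset !inE /=.
apply/andP/mapP => [[jF /eqP ki]|[j' + [-> ->]]].
  exists j; last by rewrite ki.
  by rewrite mem_filter mem_irange -ki jF; have /andP[] := F_box _ jF.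
by rewrite mem_filter => /andP[].
Qed.

End Consistency.

Lemma sum_count (s : seq int) (P : pred int) :
  \sum_(j <- s) (P j)%:Z = (count P s)%:Z.
Proof.
by elim: s => [|j s IHs]; rewrite ?big_nil // big_cons IHs /= PoszD.
Qed.

(** This is the necessity half of the Gale-Ryser theorem: within the first k rows, column j of a
    realisation F has at most min(c_j, k) points. *)
Lemma init_profile (m n : nat) (R : m.-tuple int) (C : n.-tuple int) :
  (0 < m)%N -> entry R 1 = n%:Z -> sorted >=%R R -> consistent R C ->
  let st := State (irange 1 n%:Z) (entry R) [::] in
  profile m (b_of m (entry C) st) (r_of m st).
Proof.
move=> m_gt0 R1 R_sorted [F [F_box F_row F_col]] st.
pose a (j k : int) := count (fun i => (i, j) \in F) (irange 1 k).
have r_in (i : int) : 1 <= i <= m%:Z -> r_of m st i = entry R i.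
  by move=> im; rewrite /r_of /on_rows im.
have aS (j k : int) : 1 <= k -> (a j k)%:Z = (a j (k - 1))%:Z + ((k, j) \in F)%:Z.
  by move=> k1; apply: count_irangeS.
have a_le (j k : int) : 0 <= k -> (a j k)%:Z <= k.
  move=> k0; apply: (@le_trans _ _ (size (irange 1 k))%:Z).
    by rewrite lez_nat count_size.
  by rewrite size_irange; lia.
have aC (j : int) : 1 <= j <= n%:Z -> (a j m%:Z)%:Z = entry C j.
  by move=> jn; rewrite -F_col // (col_sumE m n).
(* Within the first k rows, min(c_j, k) counts column j of the neighbour F_1 and [a j k] counts
   column j of F. *)
pose S (k : int) := \sum_(j <- irange 1 n%:Z) (Num.min (entry C j) k - (a j k)%:Z).
have SS (i : int) : 1 <= i <= m%:Z ->
    S i = S (i - 1) + (b_of m (entry C) st i - r_of m st i).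
  move=> im; rewrite r_in // -F_row // (row_sumE m n) // b_of_in //.
  rewrite -!sum_count -sumrB -big_split /=; apply: eq_bigr => j _.
  have -> : Num.min (entry C j) i =
      Num.min (entry C j) (i - 1) + (i <= entry C j)%R%:Z by lia.
  by rewrite aS ?opprD 1?addrACA //; case/andP: im.
have Sge (i : int) : 0 <= i <= m%:Z -> 0 <= S i.
  move=> im; rewrite /S big_seq; apply: sumr_ge0 => j.
  rewrite mem_irange => jn.
  have := count_irange_le (fun i => (i, j) \in F) i m%:Z.
  rewrite -/(a j i) -/(a j m%:Z) aC //; have := a_le j i; lia.
have S0 : S 0 = 0.
  rewrite /S big_seq big1 // => j; rewrite mem_irange => jn.
  have := a_le j 0; have := aC j jn; lia.
have Sm : S m%:Z = 0.
  rewrite /S big_seq big1 // => j; rewrite mem_irange => jn.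
  by have := a_le j m%:Z; have := aC j jn; lia.
split.
- by apply: le_antitone => i im; apply: b_of_antitone; lia.
- apply: le_antitone => i im; rewrite [leRHS]r_in; last lia.
  have [->|iNm] := eqVneq i m%:Z.
    by rewrite r_of_out -F_row //; lia.
  rewrite r_in; last lia.
  have /(sortedP 0)/(_ `|i|%N.-1) := R_sorted; rewrite size_tuple /entry.
  have -> : `|i|%N.-1.+1 = `|(i + 1)%R|%N.-1 by lia.
  by apply; lia.
- exact: b_of_out.
- exact: r_of_out.
(* There are n columns, so b_1 <= n = r_1; the reverse inequality is S 1 >= 0. *)
- have b1 : b_of m (entry C) st 1 <= n%:Z.
    rewrite b_of_in; last lia.
    have sJ : (size (irange 1 n%:Z))%:Z = n%:Z by rewrite size_irange; lia.
    by rewrite -[leRHS]sJ lez_nat count_size.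
  have := SS 1; have := Sge 1; rewrite r_in ?R1 // subrr S0; lia.
- by exists S.
Qed.

(** * The bound for F_2: at most 2n - 2 segments, two boundary pairs each *)

Theorem theorem3 (m n : nat) (hm : (0 < m)%N) (hn : (2 <= n)%N)
  (R : m.-tuple int) (C : n.-tuple int)
  (hR1 : entry R 1 = n%:Z) (hR : sorted >=%R R)
  (hC1 : entry C 1 = m%:Z) (hC : sorted >=%R C)
  (hcons : consistent R C) :
  (Lh (F2 R C) <= 4 * n - 4)%N.
Proof.
have prof := init_profile _ _ R C hm hR1 hR hcons.
have budget0 := segment_budget_init m n (entry C) _ prof erefl erefl hm hn hC1.
have budgetn k : segment_budget m n (entry C)
    (iter k (step m (entry C)) (State (irange 1 n%:Z) (entry R) [::])).
  by elim: k => //= k IHk; apply: segment_budget_step.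
have [L F2L sL] := segment_budget_segments _ _ _ _ (budgetn n).
apply: (@leq_trans (2 * size L)); last by lia.
by apply: Lh_le => p; rewrite /F2 in_fset -F2L.
Qed.
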